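(* Let $B:[0,1]\to[0,1]$ be the Neyman-Pearson boundary of some pair of probability measures. Then $B$ is also the Neyman-Pearson boundary of the pair $(P,Q)$ of distributions on the unit interval, where $P=U(0,1)$ is the uniform distribution (Lebesgue measure) and $Q$ is the distribution with cumulative distribution function $F(x)=B^{-1}(1-x)$, where $B^{-1}(y)=\inf\{\alpha\in[0,1]:B(\alpha)\le y\}$ for $y\in(0,1]$, so that this defines $F$ on $[0,1)$, and $F(1)=1$.
   Context: Tests: for probability measures $P,Q$ on a measurable space, the hypotheses are $H_0$: $x$ is a sample from $Q$, and $H_1$: $x$ is a sample from $P$. A (possibly randomized) test is a measurable $\phi:\Omega\to[0,1]$, accepting $H_0$ with probability $\phi(x)$ and $H_1$ with probability $1-\phi(x)$; its false positive rate is $\alpha=\int(1-\phi)\,dQ$ and its false negative rate is $\beta=\int\phi\,dP$. The Neyman-Pearson region of $(P,Q)$ is the set of all $(\alpha,\beta)$ attained by tests, and the Neyman-Pearson boundary is the function $B(\alpha)=\min\{\beta:(\alpha,\beta)\text{ in the region}\}$, $\alpha\in[0,1]$. *)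

(* Defs.v *)
From mathcomp Require Import all_boot all_order all_algebra.
From mathcomp Require Import all_classical all_reals all_analysis.

Set Implicit Arguments.
Unset Strict Implicit.
Unset Printing Implicit Defensive.

Import Order.TTheory GRing.Theory Num.Theory.
Local Open Scope classical_set_scope.
Local Open Scope ring_scope.

(* [phi x] is the probability of accepting H_0 ("x is drawn from Q") on the
   observation [x]; H_1 is "x is drawn from P". *)
Definition np_test (R : realType) (d : measure_display) (T : measurableType d)
    (phi : T -> R) : Prop :=
  measurable_fun [set: T] phi /\ forall x, 0 <= phi x <= 1.

Definition false_positive_rate (R : realType) (d : measure_display)
    (T : measurableType d) (Q : probability T R) (phi : T -> R) : R :=
  \int[Q]_x (1 - phi x).

Definition false_negative_rate (R : realType) (d : measure_display)
    (T : measurableType d) (P : probability T R) (phi : T -> R) : R :=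
  \int[P]_x phi x.

Definition np_region (R : realType) (d : measure_display)
    (T : measurableType d) (P Q : probability T R) : set (R * R) :=
  [set (false_positive_rate Q phi, false_negative_rate P phi)
     | phi in [set phi : T -> R | np_test phi]].

(* The boundary is a function on [0, 1]: the values of [B] outside [0, 1] are
   unconstrained. *)
Definition is_np_boundary (R : realType) (d : measure_display)
    (T : measurableType d) (P Q : probability T R) (B : R -> R) : Prop :=
  forall alpha : R, 0 <= alpha <= 1 ->
    np_region P Q (alpha, B alpha) /\
    (forall beta : R, np_region P Q (alpha, beta) -> B alpha <= beta).

(* Meaningful for 0 < y <= 1. *)
Definition np_boundary_inv (R : realType) (B : R -> R) (y : R) : R :=
  inf [set alpha : R | 0 <= alpha <= 1 /\ B alpha <= y].

(* Meaningful for 0 <= x <= 1. *)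
Definition np_cdf (R : realType) (B : R -> R) (x : R) : R :=
  if x < 1 then np_boundary_inv B (1 - x) else 1.

(* A distribution on the unit interval is represented by a Borel probability
   measure on the line that gives mass 1 to [0, 1]; only the restriction of its
   cumulative distribution function to [0, 1] carries information. *)
Definition unit_distribution_with_cdf (R : realType) (F : R -> R)
    (Q : probability (measurableTypeR R) R) : Prop :=
  Q (`[0, 1]%classic : set R) = 1%E /\
  forall x : R, 0 <= x <= 1 -> Q (`]-oo, x]%classic : set R) = (F x)%:E.

(* Main.v *)
Require Import Defs.
From HB Require Import structures.
From mathcomp Require Import all_boot all_order all_algebra.
From mathcomp Require Import all_classical all_reals all_analysis.
From mathcomp Require Import measurable_realfun ring lra.
Import Order.TTheory GRing.Theory Num.Theory.
Import numFieldNormedType.Exports.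
Local Open Scope classical_set_scope.
Local Open Scope ring_scope.

(** A Neyman-Pearson boundary [B] vanishes at 1, takes values in [0, 1] and is
    convex, because mixtures of tests are tests. The only other property needed
    is that it does not jump upwards at the level 0
    ([np_boundary_closed0]); this is where countable additivity enters, through
    a Borel-Cantelli and Fatou argument. These properties are collected in
    [np_curve].

    For such a [B], put [F := np_cdf B]. Closedness gives
    [B (F x) <= 1 - x], while [F x <= a] as soon as [B a <= 1 - x]; hence [F] is
    convex, with [F 0 = 0] and [F 1 = 1]. Since the
    levels [u] such that [1 - B u <= x] form the segment from 0 to [F x], up to
    its end point, the law of [1 - B u] for uniform [u] has cdf [F].

    Let [Q] have cdf [F] on the unit interval and let [U] be uniform. Convexity
    of [F] says that the density of [Q] with respect to [U] increases, apart
    from a possible atom at 1, so that the most powerful tests reject on initial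
    segments. At the level of
    measures: if [k] is a subgradient of [F] at [t], then [Q <= k U] on
    half-open intervals to the left of [t] and [k U <= Q] on those to its right,
    and these inequalities extend to Borel sets because a probability measure is
    the outer measure generated by its values on half-open intervals
    ([le_probability_ocitv]). Integrating a rejection probability [psi] of
    uniform mass [t] gives the [bathtub] inequality [F t <= \int[Q] psi].
    Applying [B] turns it into [B alpha <= beta] for every test of [U] against
    [Q], and the thresholds [x > 1 - B alpha] attain equality. When
    [B alpha = 0] the test must be randomized on the atom that [Q] may have at
    1. *)

(** * Convexity on the unit interval and the inverse of a boundary *)

Lemma unit_mix (R : realType) (s a b : R) :
  0 <= s <= 1 -> 0 <= a <= 1 -> 0 <= b <= 1 -> 0 <= s * a + (1 - s) * b <= 1.
Proof.
move=> /andP[s0 s1] /andP[a0 a1] /andP[b0 b1].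
have sC : 0 <= 1 - s by rewrite subr_ge0.
rewrite addr_ge0 ?mulr_ge0//=.
have := ler_wpM2l s0 a1; have := ler_wpM2l sC b1; lra.
Qed.

Definition convex_unit {R : realType} (f : R -> R) : Prop :=
  forall s a b : R, 0 <= s <= 1 -> 0 <= a <= 1 -> 0 <= b <= 1 ->
  f (s * a + (1 - s) * b) <= s * f a + (1 - s) * f b.

Lemma convex_unit_chord (R : realType) (f : R -> R) (a x b : R) :
  convex_unit f -> 0 <= a -> a <= x <= b -> b <= 1 ->
  (b - a) * f x <= (b - x) * f a + (x - a) * f b.
Proof.
move=> cf a0 /andP[ax xb] b1.
have [ab|ba] := ltP a b; last first.
  have -> : x = a by lra.
  have -> : b = a by lra.
  lra.
pose s := (b - x) / (b - a).
have ba0 : 0 < b - a by rewrite subr_gt0.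
have sE : s * (b - a) = b - x by rewrite /s divfK// gt_eqF.
have s01 : 0 <= s <= 1.
  apply/andP; split; first by apply: divr_ge0; lra.
  by rewrite ler_pdivrMr// mul1r; lra.
have := cf s a b s01 _ _.
have -> : s * a + (1 - s) * b = x by lra.
move=> /(_ ltac:(lra) ltac:(lra)) H.
have := ler_wpM2l (ltW ba0) H.
by nra.
Qed.

(** The intrinsic description of Neyman-Pearson boundaries. Convexity controls
    the behaviour from the right at every level except 0, where it has to be
    required separately by the last field. *)
Record np_curve {R : realType} (B : R -> R) : Prop := NPCurve {
  np_curve_ge0 : forall a, 0 <= a <= 1 -> 0 <= B a ;
  np_curve0_le1 : B 0 <= 1 ;
  np_curve1 : B 1 = 0 ;
  np_curve_convex : convex_unit B ;
  np_curve_closed0 : forall y, (forall a, 0 < a <= 1 -> B a <= y) -> B 0 <= y }.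

Section np_curve_theory.
Context {R : realType} (B : R -> R).
Hypothesis cB : np_curve B.

(** The chord from [(a, B a)] to [(1, 0)] lies above the curve. Besides
    monotonicity it yields strict decrease as long as [B] is positive. *)
Lemma np_curve_contract a b :
  0 <= a -> a <= b <= 1 -> (1 - a) * B b <= (1 - b) * B a.
Proof.
move=> a0 ab1.
have := convex_unit_chord _ B a b 1 (np_curve_convex B cB) a0 ab1 (lexx _).
by rewrite (np_curve1 B cB) mulr0 addr0.
Qed.

Lemma np_curve_nonincreasing a b : 0 <= a -> a <= b <= 1 -> B b <= B a.
Proof.
move=> a0 /andP[ab b1].
have [b1'|b1'] := ltP b 1; last first.
  have -> : b = 1 by lra.
  by rewrite (np_curve1 B cB) (np_curve_ge0 B cB)//; lra.
have := np_curve_contract a b a0 (introT andP (conj ab b1)).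
have Ba : 0 <= B a by apply: (np_curve_ge0 B cB); lra.
move=> H; rewrite -(ler_pM2l (_ : 0 < 1 - a)); last by lra.
by apply: (le_trans H); apply: ler_wpM2r => //; lra.
Qed.

Lemma np_curve_le1 a : 0 <= a <= 1 -> B a <= 1.
Proof.
move=> a01; apply: le_trans (np_curve0_le1 B cB).
by apply: np_curve_nonincreasing.
Qed.

(** This is what makes the infimum in the inverse of [B] a minimum. Inside the
    interval a convex function is bounded by its values on the right through the chords
    starting at 0, and at 0 itself this is the last field of [np_curve]. *)
Lemma np_curve_closed a y : 0 <= a < 1 ->
  (forall b, a < b <= 1 -> B b <= y) -> B a <= y.
Proof.
move=> /andP[a0 a1] By.
have [a00|a_neq0] := eqVneq a 0.
  by rewrite a00; apply: (np_curve_closed0 B cB) => b b01; apply: By; lra.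
have {a_neq0}a0 : 0 < a by rewrite lt_neqAle eq_sym a_neq0.
apply/ler_addgt0Pr => e e0.
(* the chord from 0 to a + d bounds B a by y + (d / a) * (B 0 - B a), and
   B 0 - B a <= 1 *)
pose d := Num.min (a * e) (1 - a).
have d0 : 0 < d by rewrite lt_min mulr_gt0 ?subr_gt0.
have dae : d <= a * e by rewrite ge_min lexx.
have d1a : d <= 1 - a by rewrite ge_min lexx orbT.
have := convex_unit_chord _ B 0 a (a + d) (np_curve_convex B cB) (lexx _).
move=> /(_ ltac:(lra) ltac:(lra)).
have Bad : B (a + d) <= y by apply: By; lra.
have B0 := np_curve0_le1 B cB.
have Ba : 0 <= B a by apply: (np_curve_ge0 B cB); lra.
rewrite !subr0 [a + d - a]addrC addKr => H.
have H1 : a * B a <= d + a * y.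
  have : d * B 0 <= d by rewrite ger_pMr.
  have : a * B (a + d) <= a * y by rewrite ler_pM2l.
  have : 0 <= d * B a by rewrite mulr_ge0// ltW.
  by lra.
rewrite -(ler_pM2l a0); lra.
Qed.

Let F := np_cdf B.

Let lo (y : R) : set R := [set a : R | 0 <= a <= 1 /\ B a <= y].

Let lo1 y : 0 <= y -> lo y 1.
Proof. by move=> y0; split; rewrite ?(np_curve1 B cB)// ler01 lexx. Qed.

Lemma np_cdf1 : F 1 = 1.
Proof. by rewrite /F /np_cdf ltxx. Qed.

Lemma np_cdf_le x a : x < 1 -> 0 <= a <= 1 -> B a <= 1 - x -> F x <= a.
Proof.
move=> x1 a01 Ba; rewrite /F /np_cdf x1; apply: ge_inf => //.
by exists 0 => b [/andP[]].
Qed.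

Lemma np_cdf_unit x : 0 <= x <= 1 -> 0 <= F x <= 1.
Proof.
move=> /andP[x0 x1]; have [x1'|x1'] := ltP x 1; last first.
  by rewrite /F /np_cdf ltNge x1' /= ler01 lexx.
apply/andP; split; last first.
  by apply: np_cdf_le; rewrite ?(np_curve1 B cB)//; lra.
rewrite /F /np_cdf x1'; apply: lb_le_inf; last by move=> b [/andP[]].
by exists 1; apply: lo1; lra.
Qed.

Lemma np_curve_np_cdf x : 0 <= x <= 1 -> B (F x) <= 1 - x.
Proof.
move=> x01; have /andP[F0 F1] := np_cdf_unit x x01.
have [Fx1|Fx1] := ltP (F x) 1; last first.
  have -> : F x = 1 by apply/le_anti; rewrite F1.
  by rewrite (np_curve1 B cB); lra.
have x1 : x < 1.
  by move: Fx1; rewrite /F /np_cdf; case: ifP => // _; rewrite ltxx.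
apply: np_curve_closed => [|b /andP[Fb b1]]; first by rewrite F0.
have y0 : 0 <= 1 - x by lra.
have [c [c01 Bc] cb] : exists2 c, lo (1 - x) c & c < b.
  apply: inf_lt; first by exists 1; exact: lo1.
  by move: Fb; rewrite /F /np_cdf x1.
by apply: le_trans Bc; apply: np_curve_nonincreasing; lra.
Qed.

Lemma np_cdf0 : F 0 = 0.
Proof.
apply/le_anti/andP; split; last first.
  by have /andP[] := np_cdf_unit 0 (introT andP (conj (lexx _) ler01)).
by apply: np_cdf_le; rewrite ?ltr01 ?lexx ?ler01// subr0; exact: np_curve0_le1.
Qed.

(** [B (F x) <= 1 - x] at the two end points and convexity of [B] make the mean
    of [F x] and [F y] a competitor in the infimum that defines [F] at the mean
    of [x] and [y]. The point 1, where [F] is set by hand, is separate. *)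
Lemma np_cdf_convex : convex_unit F.
Proof.
move=> s x y s01 x01 y01.
have Fx := np_cdf_unit x x01; have Fy := np_cdf_unit y y01.
have m01 : 0 <= s * F x + (1 - s) * F y <= 1 by exact: unit_mix.
have [m1|m1] := ltP (s * x + (1 - s) * y) 1; last first.
  (* a mean of two points of the unit interval is 1 only if each point of
     nonzero weight is 1 *)
  have sx : 0 <= s * (1 - x) by apply: mulr_ge0; lra.
  have sy : 0 <= (1 - s) * (1 - y) by apply: mulr_ge0; lra.
  have -> : s * x + (1 - s) * y = 1 by lra.
  have /eqP : s * (1 - x) = 0 by lra.
  have /eqP : (1 - s) * (1 - y) = 0 by lra.
  rewrite !mulf_eq0 !subr_eq0 np_cdf1.
  by move=> /orP[/eqP<-|/eqP<-] /orP[/eqP->|/eqP<-]; rewrite ?np_cdf1; lra.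
apply: np_cdf_le => //.
apply: le_trans (np_curve_convex B cB s _ _ s01 Fx Fy) _.
have Bx := np_curve_np_cdf x x01; have By := np_curve_np_cdf y y01.
have /andP[s0 s1] := s01.
have sC : 0 <= 1 - s by rewrite subr_ge0.
have := ler_wpM2l s0 Bx; have := ler_wpM2l sC By; lra.
Qed.

(** Below a positive value [B] is injective by [np_curve_contract], so the first
    level at which [B] reaches [B a] is [a]. *)
Lemma np_cdf_np_curve a : 0 <= a <= 1 -> 0 < B a -> F (1 - B a) = a.
Proof.
move=> a01 Ba0.
have x1 : 1 - B a < 1 by lra.
have Ba1 := np_curve_le1 a a01.
apply/le_anti/andP; split; first by apply: np_cdf_le => //; lra.
have F01 := np_cdf_unit (1 - B a) ltac:(lra).
have := np_curve_np_cdf (1 - B a) ltac:(lra).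
rewrite leNgt => BF; apply/negP => Fa.
have := np_curve_contract (F (1 - B a)) a ltac:(lra) ltac:(lra).
nra.
Qed.

End np_curve_theory.

(** * Comparison of measures and of integrals *)

Section measure_comparison.
Local Open Scope ereal_scope.

(** A probability on the line is the Lebesgue-Stieltjes measure of its cdf, that
    is, an infimum of sums over countable covers by half-open intervals; any
    measure that is smaller on these intervals is smaller on each cover. *)
Lemma le_probability_ocitv (R : realType)
    (mu : {measure set (measurableTypeR R) -> \bar R})
    (nu : probability (measurableTypeR R) R) (A : set (measurableTypeR R)) :
  (forall a b : R, (a <= b)%R -> mu `]a, b]%classic <= nu `]a, b]%classic) ->
  measurable A -> mu A <= nu A.
Proof.
move=> munu mA; rewrite -(lebesgue_stieltjes_cdf_id nu mA).
rewrite /lebesgue_stieltjes_measure /measure_extension /mu_ext.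
apply: le_ereal_inf_tmp => _ [G [mG AG] <-].
have mG' k : measurable (G k : set (measurableTypeR R)).
  by apply: sub_sigma_algebra; exact: mG.
apply: (@le_trans _ _ (\sum_(k <oo) mu (G k))).
  by apply: measure_sigma_subadditive.
apply: lee_nneseries => // k _.
have [[a b] _ /= <-] := mG k.
have [ab|ba] := leP a b; last first.
  by rewrite set_itv_ge ?wlength0 ?measure0// bnd_simp -leNgt ltW.
apply: le_trans (munu _ _ ab) _.
rewrite -(lebesgue_stieltjes_cdf_id nu)//.
rewrite /lebesgue_stieltjes_measure /measure_extension.
by rewrite measurable_mu_extE//=; exact: is_ocitv.
Qed.

Import HBNNSimple.

(** The integral is a supremum over simple functions below [f], whose nonzero
    level sets are contained in [D]. *)
Lemma le_measure_integral d (T : measurableType d) (R : realType)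
    (mu nu : {measure set T -> \bar R}) (D : set T) (f : T -> \bar R) :
  measurable D -> (forall x, D x -> 0 <= f x) ->
  (forall A, measurable A -> A `<=` D -> mu A <= nu A) ->
  \int[mu]_(x in D) f x <= \int[nu]_(x in D) f x.
Proof.
move=> mD f0 munu.
rewrite integral_mkcond [leRHS]integral_mkcond.
have fD0 x : 0 <= (f \_ D) x by apply: erestrict_ge0.
rewrite !ge0_integralTE//.
apply: ge_ereal_sup => _ [h hf <-].
apply: (@le_trans _ _ (sintegral nu h)); last first.
  by apply: ereal_sup_ubound; exists h.
rewrite !sintegralE; apply: lee_fsum => [|r _]; first exact: fimfun_inP.
have [->|r0] := eqVneq r 0%R; first by rewrite !mul0e.
have [r1|r1] := ltP r 0%R.
  rewrite preimage_nnfun0// !measure0 !mule0//.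
apply: lee_wpmul2l; first by rewrite lee_fin.
apply: munu => // x /= hx.
move: (hf x); rewrite patchE hx; case: ifPn => [xD _|_]; first exact: set_mem.
by rewrite lee_fin => r2; move: r0; rewrite eq_le r1 r2.
Qed.

End measure_comparison.

(** * Tests and their error rates *)

Section test_rates.
Context {R : realType} {d : measure_display} {T : measurableType d}.
Implicit Types (P Q : probability T R) (phi : T -> R).

Lemma np_test_integrable P D phi :
  measurable D -> np_test phi -> P.-integrable D (EFin \o phi).
Proof.
move=> mD [mphi phi01].
apply: (le_integrable mD (g := EFin \o cst 1)).
- by apply/measurable_EFinP; exact: measurable_funTS.
- move=> x _ /=; have /andP[p0 p1] := phi01 x.
  by rewrite lee_fin normr1 ger0_norm.
- exact: finite_measure_integrable_cst.
Qed.

Lemma np_testC phi : np_test phi -> np_test (fun x => 1 - phi x).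
Proof.
move=> [mphi phi01]; split; first exact: measurable_funB.
by move=> x; have := phi01 x; lra.
Qed.

Lemma np_test_cst (c : R) : 0 <= c <= 1 -> np_test (fun _ : T => c).
Proof. by move=> c01; split => //; exact: measurable_cst. Qed.

Lemma np_test_indic A : measurable A -> np_test (\1_A : T -> R).
Proof.
move=> mA; split; first exact: measurable_indic.
by move=> x; rewrite indicE; case: (x \in A); rewrite /= ?lexx ?ler01.
Qed.

Lemma np_testZ (c : R) phi : 0 <= c <= 1 -> np_test phi ->
  np_test (fun x => c * phi x).
Proof.
move=> /andP[c0 c1] [mphi phi01]; split; first exact: measurable_funM.
move=> x; have /andP[p0 p1] := phi01 x.
by rewrite mulr_ge0//= mulr_ile1.
Qed.

Lemma false_positive_rateE Q phi : np_test phi ->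
  false_positive_rate Q phi = 1 - false_negative_rate Q phi.
Proof.
move=> tphi; rewrite /false_positive_rate /false_negative_rate RintegralB//.
- by rewrite Rintegral_cst// mul1r (congr1 fine (probability_setT Q)).
- exact: finite_measure_integrable_cst.
- exact: np_test_integrable.
Qed.

Lemma false_negative_rate_unit P phi : np_test phi ->
  0 <= false_negative_rate P phi <= 1.
Proof.
move=> tphi; apply/andP; split.
  by apply: Rintegral_ge0 => x _; have /andP[] := tphi.2 x.
rewrite -subr_ge0 -false_positive_rateE//.
by apply: Rintegral_ge0 => x _; have := tphi.2 x; lra.
Qed.

Lemma false_negative_rate_mix P (s : R) phi psi :
  0 <= s <= 1 -> np_test phi -> np_test psi ->
  false_negative_rate P (fun x => s * phi x + (1 - s) * psi x) =
  s * false_negative_rate P phi + (1 - s) * false_negative_rate P psi.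
Proof.
move=> s01 tphi tpsi; rewrite /false_negative_rate RintegralD//.
- by rewrite !RintegralZl//; exact: np_test_integrable.
- by apply: np_test_integrable => //; exact: np_testZ.
- by apply: np_test_integrable => //; apply: np_testZ => //; lra.
Qed.

Lemma false_negative_rate_indic P A : measurable A ->
  false_negative_rate P (\1_A : T -> R) = fine (P A).
Proof.
by move=> mA; rewrite /false_negative_rate /Rintegral integral_indic// setIT.
Qed.

Lemma np_region_convex P Q (s : R) (r1 r2 : R * R) : 0 <= s <= 1 ->
  np_region P Q r1 -> np_region P Q r2 ->
  np_region P Q (s * r1.1 + (1 - s) * r2.1, s * r1.2 + (1 - s) * r2.2).
Proof.
move=> s01 [phi tphi <-] [psi tpsi <-].
have tm : np_test (fun x => s * phi x + (1 - s) * psi x).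
  split; last by move=> x; apply: unit_mix; [|exact: tphi.2|exact: tpsi.2].
  by apply: measurable_funD; apply: measurable_funM => //; [exact: tphi.1|exact: tpsi.1].
exists (fun x => s * phi x + (1 - s) * psi x) => //=.
rewrite !false_positive_rateE// !false_negative_rate_mix//.
by congr (_, _); ring.
Qed.

End test_rates.

(** * Properties of a Neyman-Pearson boundary *)

Section np_boundary_np_curve.
Context {R : realType} {d : measure_display} {T : measurableType d}.
Context (P Q : probability T R) (B : R -> R).
Hypothesis hB : is_np_boundary P Q B.

Lemma np_boundary_le (phi : T -> R) : np_test phi ->
  B (false_positive_rate Q phi) <= false_negative_rate P phi.
Proof.
move=> tphi; apply: (hB _ _).2; last by exists phi.
by have := false_negative_rate_unit Q phi tphi; rewrite false_positive_rateE//; lra.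
Qed.

(** Take optimal tests [phi n] at the summable levels [2 ^ - n.+1], and let [A] be
    the set where the sum of the rejection probabilities [1 - phi n] is finite.
    It has full [Q]-measure since the sum is [Q]-integrable, so its indicator is
    a test of level 0. On [A] the [phi n] tend to 1, hence Fatou bounds the
    false negative rate [P A] of that test by the bound on those of [phi n]. *)
Lemma np_boundary_closed0 y : (forall a, 0 < a <= 1 -> B a <= y) -> B 0 <= y.
Proof.
move=> By.
pose q n : R := 1 / (2 ^ n.+1)%:R.
have q01 n : 0 < q n <= 1.
  have p0 : 0 < (2 ^ n.+1)%:R :> R by rewrite ltr0n expn_gt0.
  by rewrite /q divr_gt0//= ler_pdivrMr// mul1r ler1n expn_gt0.
have /choice[phi phiP] : forall n, exists phi : T -> R, [/\ np_test phi,
    false_positive_rate Q phi = q n & false_negative_rate P phi <= y].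
  move=> n; have [[phi tphi [fp fn]] _] := hB (q n) ltac:(have := q01 n; lra).
  by exists phi; split => //; rewrite fn; exact: By.
have tphi n : np_test (phi n) by have [] := phiP n.
pose u n x : \bar R := (1 - phi n x)%:E.
have u0 n x : (0 <= u n x)%E by rewrite lee_fin; have := (tphi n).2 x; lra.
have mu n : measurable_fun setT (u n).
  by apply/measurable_EFinP; exact: (np_testC _ (tphi n)).1.
pose g x := (\sum_(n <oo) u n x)%E.
have mg : measurable_fun setT g by apply: ge0_emeasurable_sum => // n x _ _.
have g0 x : (0 <= g x)%E by apply: nneseries_ge0.
have intg : (\int[Q]_x g x <= 1)%E.
  rewrite integral_nneseries//.
  apply: (@le_trans _ _ (\sum_(n <oo) (q n)%:E)%E); last exact: epsilon_trick0.
  apply: lee_nneseries => [n _ _|n _]; first exact: integral_ge0.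
  have [_ <- _] := phiP n.
  rewrite /false_positive_rate /Rintegral fineK//.
  by apply: integrable_fin_num => //; apply: np_test_integrable => //; exact: np_testC.
pose A := [set x | (g x < +oo)%E].
have mA : measurable A.
  by rewrite -[A]setTI; exact: emeasurable_fun_infty_o.
have QA : Q A = 1%E.
  have ig : Q.-integrable setT g.
    apply/integrableP; split => //.
    under eq_integral do rewrite gee0_abs//.
    exact: le_lt_trans intg (ltry _).
  have [N [mN N0 subN]] := integrable_ae measurableT ig.
  rewrite -[A]setCK probability_setC; last exact: measurableC.
  rewrite (_ : Q (~` A) = 0%E) ?sube0//; apply: subset_measure0 N0 => //.
    exact: measurableC.
  move=> x nAx; apply: subN => /= gx; apply: nAx.
  by rewrite /A /= -ge0_fin_numE//; exact: gx.
have PA : (P A <= y%:E)%E.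
  have mphi n : measurable_fun A (fun x => (phi n x)%:E).
    by apply/measurable_EFinP/measurable_funTS; exact: (tphi n).1.
  have phi0 n x : A x -> (0 <= (phi n x)%:E)%E.
    by move=> _; rewrite lee_fin; have /andP[] := (tphi n).2 x.
  have := fatou P mA mphi phi0.
  rewrite (_ : (\int[P]_(x in A) _ = P A)%E); last first.
    transitivity (\int[P]_(x in A) 1)%E; last by rewrite integral_cst// mul1e.
    apply: eq_integral => x /set_mem Ax; apply: (cvg_limn_einf_sup _).1.
    (* a convergent series of nonnegative terms has terms tending to 0 *)
    have /cvg_series_cvg_0 c0 : cvgn (series (fun n => 1 - phi n x)).
      by apply: nnseries_is_cvg => // n; have := u0 n x; rewrite lee_fin.
    apply/fine_cvgP; split; first exact: nearW.
    have -> : fine \o (fun n => (phi n x)%:E) = (fun n => 1 - (1 - phi n x)).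
      by apply/funext => n /=; ring.
    rewrite -[X in _ --> X]subr0; apply: cvgB c0; exact: cvg_cst.
  move=> /le_trans; apply; rewrite limn_einf_lim; apply: lime_le.
    exact: is_cvg_einfs.
  apply: nearW => n.
  apply: (@le_trans _ _ (\int[P]_(x in A) (phi n x)%:E)%E).
    by apply: ereal_inf_lbound; exists n => /=.
  apply: (@le_trans _ _ (\int[P]_x (phi n x)%:E)%E).
    apply: ge0_subset_integral => //.
    - by apply/measurable_EFinP; exact: (tphi n).1.
    - by move=> x _; rewrite lee_fin; have /andP[] := (tphi n).2 x.
  have [_ _] := phiP n; rewrite -lee_fin /false_negative_rate /Rintegral fineK//.
  by apply: integrable_fin_num => //; exact: np_test_integrable.
have := np_boundary_le _ (np_test_indic A mA).
rewrite false_positive_rateE; last exact: np_test_indic.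
rewrite !false_negative_rate_indic// QA subrr => /le_trans; apply.
by rewrite -lee_fin fineK// fin_num_measure.
Qed.

Lemma np_boundary_np_curve : np_curve B.
Proof.
have one01 : 0 <= (1 : R) <= 1 by rewrite ler01 lexx.
have zero01 : 0 <= (0 : R) <= 1 by rewrite ler01 lexx.
split.
- move=> a a01; have [[phi tphi [_ <-]] _] := hB a a01.
  by have /andP[] := false_negative_rate_unit P phi tphi.
- have t1 := np_test_cst 1 one01 : np_test (fun _ : T => 1 : R).
  have := np_boundary_le _ t1.
  rewrite false_positive_rateE// /false_negative_rate !Rintegral_cst//.
  rewrite (congr1 fine (probability_setT P)) (congr1 fine (probability_setT Q)).
  by rewrite mulr1 subrr.
- apply/le_anti/andP; split; last first.
    have [[phi tphi [_ <-]] _] := hB 1 one01.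
    by have /andP[] := false_negative_rate_unit P phi tphi.
  have t0 := np_test_cst 0 zero01 : np_test (fun _ : T => 0 : R).
  have := np_boundary_le _ t0.
  by rewrite false_positive_rateE// /false_negative_rate !Rintegral_cst// !mul0r subr0.
- move=> s a b s01 a01 b01.
  have [ra _] := hB a a01; have [rb _] := hB b b01.
  have [_] := hB (s * a + (1 - s) * b) (unit_mix _ _ _ _ s01 a01 b01).
  by apply; exact: (np_region_convex P Q s (a, B a) (b, B b)).
- exact: np_boundary_closed0.
Qed.

End np_boundary_np_curve.

(** * Distributions on the unit interval *)

Section unit_distributions.
Context {R : realType}.
Implicit Types (Q : probability (measurableTypeR R) R) (F : R -> R).

(** The projection onto the unit interval. It reduces the values of a cdf on the
    whole line to those on [0, 1]. *)
Definition clip (x : R) : R := Num.max 0 (Num.min x 1).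

Lemma clip_unit x : 0 <= clip x <= 1.
Proof. by rewrite /clip le_max lexx /= ge_max ler01 /= ge_min lexx orbT. Qed.

Lemma clip_id x : 0 <= x <= 1 -> clip x = x.
Proof. by move=> /andP[x0 x1]; rewrite /clip min_l// max_r. Qed.

Lemma clip_nondecreasing : {homo clip : x y / x <= y}.
Proof.
move=> x y xy; rewrite /clip ge_max le_max lexx /= le_max.
by rewrite (_ : Num.min x 1 <= Num.min y 1) ?orbT// le_min !ge_min xy lexx orbT.
Qed.

Lemma unit_distribution_cdf_clip F Q x : F 0 = 0 ->
  unit_distribution_with_cdf F Q -> Q `]-oo, x]%classic = (F (clip x))%:E.
Proof.
move=> F0 [Q01 QF].
have [x0|x0] := ltP x 0.
  rewrite (_ : clip x = 0) ?F0; last by rewrite /clip max_l// ge_min ltW.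
  have Q0 : Q `]-oo, 0]%classic = 0%E by rewrite QF ?F0// lexx ler01.
  apply: subset_measure0 Q0 => //.
  by apply: subset_itvl; rewrite bnd_simp ltW.
have [x1|x1] := leP x 1; first by rewrite clip_id ?x0// QF// x0.
have Q1 y : 1 <= y -> Q `]-oo, y]%classic = 1%E.
  move=> y1; apply/eqP; rewrite eq_le probability_le1//= -Q01.
  apply: le_measure; rewrite ?inE// => z /=; rewrite !in_itv/= => /andP[_ z1].
  exact: le_trans y1.
rewrite Q1 ?ltW// (_ : clip x = 1); last by rewrite /clip min_r ?max_r ?ltW.
by rewrite -QF ?Q1// ler01 lexx.
Qed.

Lemma unit_distribution_ocitv F Q a b : F 0 = 0 ->
  unit_distribution_with_cdf F Q -> a <= b ->
  Q `]a, b]%classic = (F (clip b) - F (clip a))%:E.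
Proof.
move=> F0 FQ ab.
rewrite EFinB -!(unit_distribution_cdf_clip F Q _ F0 FQ).
have -> : `]a, b]%classic = `]-oo, b] `\` `]-oo, a].
  by rewrite -[RHS]setCK setCD setCitvl setUC -[LHS]setCK setCitv.
rewrite measureD ?setIidr//; first exact: subset_itvl.
by rewrite -ge0_fin_numE// fin_num_measure.
Qed.

(** The mass of the open half-line is the left limit of the cdf at 1, which
    leaves out a possible atom at 1. *)
Lemma unit_distribution_lt1 F Q alpha : F 0 = 0 ->
  unit_distribution_with_cdf F Q ->
  (forall x, 0 <= x < 1 -> F x <= alpha) -> (Q `]-oo, 1%R[%classic <= alpha%:E)%E.
Proof.
move=> F0 [Q01 QF] Fa.
have x01 (n : nat) : 0 <= (1 - n.+1%:R^-1 : R) < 1.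
  have n0 : 0 < n.+1%:R^-1 :> R by rewrite invr_gt0.
  by rewrite subr_ge0 gtrBl n0 andbT invf_le1// ler1n.
have QE : Q `]-oo, 1 - n.+1%:R^-1]%classic @[n --> \oo] --> Q `]-oo, 1[%classic.
  rewrite (_ : `]-oo, 1[%classic = \bigcup_n `]-oo, 1 - n.+1%:R^-1]%classic); last first.
    apply/seteqP; split=> y /=; rewrite in_itv/=.
      move=> /ltr_add_invr[n yn]; exists n => //=.
      by rewrite in_itv/= lerBrDr ltW.
    by move=> [n _]/=; rewrite in_itv/= => /le_lt_trans; apply; have /andP[] := x01 n.
  apply: nondecreasing_cvg_mu => //; first exact: bigcup_measurable.
  move=> m n mn; apply/subsetPset/subset_itvl.
  by rewrite bnd_simp lerB// lef_pV2 ?posrE// ler_nat.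
rewrite -(cvg_lim _ QE)//; apply: lime_le; first by apply/cvg_ex; eexists; exact: QE.
apply: nearW => n; rewrite QF ?lee_fin ?Fa//.
by have /andP[-> /ltW] := x01 n.
Qed.

Lemma uniform_probE (A : set R) : measurable A ->
  uniform_prob (@ltr01 R) A = lebesgue_measure (A `&` `[0, 1]%classic).
Proof.
move=> mA; rewrite /uniform_prob integral_uniform_pdf.
rewrite (eq_integral (fun=> 1%E)).
  by rewrite integral_cst ?mul1e//; exact: measurableI.
move=> y; rewrite inE/= in_itv/= => -[_ y01].
by rewrite /uniform_pdf y01 subr0 invr1.
Qed.

(** The end points of the intersection with [0, 1] do not matter, so the booleans
    that say whether they belong to it are arbitrary. *)
Lemma uniform_prob_itv (i : interval R) (b0 b1 : bool) (x : R) : 0 <= x ->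
  [set` i] `&` `[0, 1]%classic = [set` Interval (BSide b0 0) (BSide b1 x)] ->
  uniform_prob (@ltr01 R) [set` i] = x%:E.
Proof.
move=> x0 iE; rewrite uniform_probE; last exact: measurable_itv.
rewrite iE; apply: etrans (lebesgue_measure_itv _) _; rewrite /= lte_fin.
have [x0'|x0'] := ltP 0 x; first by rewrite sube0.
by congr EFin; apply/le_anti; rewrite x0.
Qed.

Lemma uniform_unit_distribution :
  unit_distribution_with_cdf id (uniform_prob (@ltr01 R)).
Proof.
split; first by apply: (uniform_prob_itv _ true false); rewrite ?setIid.
move=> x /andP[x0 x1]; apply: (uniform_prob_itv _ true false) => //.
apply/seteqP; split=> y /=; rewrite !in_itv/=; first by move=> [-> /andP[->]].
by move=> /andP[-> yx]; rewrite yx (le_trans yx x1).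
Qed.

End unit_distributions.

(** * Subgradients *)

(** The slopes of the chords ending at [t] are bounded by those of the chords
    starting at [t]; their supremum separates the two families. *)
Lemma convex_unit_subgradient (R : realType) (f : R -> R) (t : R) :
  convex_unit f -> 0 < t < 1 ->
  exists k, (forall a b, 0 <= a <= b -> b <= t -> f b - f a <= k * (b - a)) /\
            (forall a b, t <= a <= b -> b <= 1 -> k * (b - a) <= f b - f a).
Proof.
move=> cf /andP[t0 t1].
pose sl a := (f t - f a) / (t - a).
pose S := [set sl a | a in [set a : R | 0 <= a < t]].
have slE a : a < t -> sl a * (t - a) = f t - f a.
  by move=> at_; rewrite /sl divfK// subr_eq0 gt_eqF.
have ubS b : t < b <= 1 -> ubound S ((f b - f t) / (b - t)).
  move=> /andP[tb b1] _ [a /andP[a0 at_] <-].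
  rewrite ler_pdivlMr ?subr_gt0// mulrAC ler_pdivrMr ?subr_gt0//.
  have := convex_unit_chord _ f a t b cf a0 _ b1; move=> /(_ ltac:(lra)).
  lra.
have S0 : S !=set0 by exists (sl 0); exists 0 => //=; rewrite lexx.
exists (sup S); split=> a b /andP[h1 h2] h3.
  have [at_|ta] := ltP a t; last first.
    have -> : b = a by lra.
    by rewrite !subrr mulr0.
  have slk : sl a <= sup S.
    apply: ub_le_sup; last by exists a => //=; rewrite h1.
    by exists ((f 1 - f t) / (1 - t)); apply: ubS; rewrite t1 lexx.
  apply: le_trans (_ : sl a * (b - a) <= _); last by apply: ler_wpM2r => //; lra.
  have := convex_unit_chord _ f a b t cf h1 _ (ltW t1); move=> /(_ ltac:(lra)) chord.
  rewrite -(ler_pM2r (_ : 0 < t - a)); last by lra.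
  by rewrite [sl a * _ * _]mulrAC slE//; lra.
have [tb|bt] := ltP t b; last first.
  have -> : b = a by lra.
  by rewrite !subrr mulr0.
have slk : sup S <= (f b - f t) / (b - t).
  by apply: ge_sup => //; apply: ubS; rewrite tb.
apply: le_trans (_ : _ <= (f b - f t) / (b - t) * (b - a)) _.
  by apply: ler_wpM2r => //; lra.
have := convex_unit_chord _ f t a b cf (ltW t0) _ h3; move=> /(_ ltac:(lra)) chord.
rewrite mulrAC ler_pdivrMr ?subr_gt0//; lra.
Qed.

(** * The bathtub inequality *)

Section bathtub.
Context {R : realType}.
Implicit Types mu nu : probability (measurableTypeR R) R.
Local Notation borel := (measurableTypeR R).

Lemma le_probability_ocitv_scaled mu nu (D : set borel) (c : R) :
  0 < c -> measurable D ->
  (forall a b : R, a <= b ->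
    (mu (`]a, b]%classic `&` D) <= c%:E * nu `]a, b]%classic)%E) ->
  forall A, measurable A -> A `<=` D -> (mu A <= c%:E * nu A)%E.
Proof.
move=> c0 mD munu A mA AD.
have ci0 : 0 <= c^-1 by rewrite invr_ge0 ltW.
have H : (c^-1%:E * mu (A `&` D) <= nu A)%E.
  apply: (@le_probability_ocitv R (mscale (NngNum ci0) (mrestr mu mD)) nu A) => // a b ab.
  rewrite /mscale /mrestr/= lee_pdivrMl//; exact: munu.
by move: H; rewrite setIidl// lee_pdivrMl.
Qed.

Lemma le_scaled_Rintegral mu nu (D : set borel) (c : R) (psi : borel -> R) :
  0 < c -> measurable D -> np_test psi ->
  (forall A, measurable A -> A `<=` D -> (mu A <= c%:E * nu A)%E) ->
  \int[mu]_(x in D) psi x <= c * \int[nu]_(x in D) psi x.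
Proof.
move=> c0 mD tpsi munu.
have psi0 x : D x -> (0 <= (psi x)%:E)%E.
  by move=> _; rewrite lee_fin; have /andP[] := tpsi.2 x.
have mpsi : measurable_fun D (EFin \o psi).
  by apply/measurable_EFinP/measurable_funTS; exact: tpsi.1.
have fin (P : probability borel R) : (\int[P]_(x in D) (psi x)%:E)%E \is a fin_num.
  by apply: integrable_fin_num => //; exact: np_test_integrable.
have := le_measure_integral _ _ _ mu (mscale (NngNum (ltW c0)) nu) D _ mD psi0 munu.
rewrite ge0_integral_mscale//=.
by move=> H; rewrite /Rintegral -lee_fin EFinM !fineK; [exact: H|exact: fin|exact: fin].
Qed.

Lemma Rintegral_np_test_split mu (D : set borel) (psi : borel -> R) :
  measurable D -> np_test psi ->
  false_negative_rate mu psi = fine (mu D)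
    - \int[mu]_(x in D) (1 - psi x) + \int[mu]_(x in ~` D) psi x.
Proof.
move=> mD tpsi; rewrite /false_negative_rate -(setUv D) Rintegral_setU//.
- congr (_ + _); rewrite RintegralB//; last 2 first.
  + exact: finite_measure_integrable_cst.
  + exact: np_test_integrable.
  by rewrite Rintegral_cst// mul1r opprB addrC subrK.
- exact: measurableC.
- by rewrite setUv; exact: np_test_integrable.
- by apply/disj_setPCl.
Qed.

Local Notation U := (uniform_prob (@ltr01 R)).

(** Among the functions [psi] with values in [0, 1] and uniform mass [t], the
    indicator of [[0, t]] has the smallest [Q]-integral. Passing from it to
    [psi] removes [1 - psi] on the left of [t], where [Q <= k U], and adds [psi]
    on the right of [t], where [k U <= Q], for a subgradient [k] of [F] at [t];
    the uniform masses removed and added are equal. *)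
Lemma bathtub (Q : probability borel R) (F : R -> R) (psi : borel -> R) :
  F 0 = 0 -> convex_unit F -> unit_distribution_with_cdf F Q -> np_test psi ->
  false_negative_rate U psi < 1 ->
  F (false_negative_rate U psi) <= false_negative_rate Q psi.
Proof.
move=> F0 cF QF tpsi; set t := false_negative_rate U psi => t1.
have /andP[t0 _] : 0 <= t <= 1 := false_negative_rate_unit U psi tpsi.
have /andP[Qpsi0 _] := false_negative_rate_unit Q psi tpsi.
have [Ft0|Ft0] := leP (F t) 0; first exact: le_trans Ft0 _.
have {}t0 : 0 < t.
  by rewrite lt_neqAle t0 andbT; apply: contraTneq Ft0 => <-; rewrite F0 ltxx.
have [k [kl kr]] := convex_unit_subgradient R F t cF (introT andP (conj t0 t1)).
have k0 : 0 < k.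
  have := kl 0 t; rewrite lexx F0 !subr0 (ltW t0) lexx => /(_ isT isT) Fk.
  by rewrite -(pmulr_lgt0 _ t0); exact: lt_le_trans Fk.
have UF := @uniform_unit_distribution R.
have tE : clip t = t by apply: clip_id; lra.
pose D : set borel := `]-oo, t]%classic.
have mD : measurable D by exact: measurable_itv.
have mD' : measurable (~` D) by exact: measurableC.
have left_le : \int[Q]_(x in D) (1 - psi x) <= k * \int[U]_(x in D) (1 - psi x).
  apply: le_scaled_Rintegral => //; first exact: np_testC.
  apply: le_probability_ocitv_scaled => // a b ab.
  rewrite (unit_distribution_ocitv id U)// -EFinM.
  have -> : `]a, b]%classic `&` D = `]a, Num.min b t]%classic.
    apply/seteqP; split=> x; rewrite /D /= !in_itv/= le_min.
      by move=> [/andP[-> ->] ->].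
    by move=> /and3P[-> -> ->].
  have [amin|amin] := leP a (Num.min b t); last first.
    rewrite set_itv_ge ?measure0; last by rewrite bnd_simp -leNgt ltW.
    by rewrite lee_fin mulr_ge0 ?(ltW k0)// subr_ge0 clip_nondecreasing.
  rewrite (unit_distribution_ocitv F Q)// lee_fin.
  have := kl (clip a) (clip (Num.min b t)).
  have /andP[-> _] := clip_unit a; rewrite (clip_nondecreasing _ _ amin).
  have cm : clip (Num.min b t) <= t.
    by rewrite -[leRHS]tE clip_nondecreasing// ge_min lexx orbT.
  move=> /(_ isT cm) /le_trans; apply.
  rewrite ler_pM2l// lerB// clip_nondecreasing//.
  by rewrite ge_min lexx.
have right_le : \int[U]_(x in ~` D) psi x <= k^-1 * \int[Q]_(x in ~` D) psi x.
  have ki0 : 0 < k^-1 by rewrite invr_gt0.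
  apply: le_scaled_Rintegral => //.
  apply: le_probability_ocitv_scaled => // a b ab.
  have -> : `]a, b]%classic `&` ~` D = `]Num.max a t, b]%classic.
    apply/seteqP; split=> x; rewrite /D /= !in_itv/= gt_max.
      by move=> [/andP[-> ->] /negP]; rewrite -ltNge => ->.
    by move=> /andP[/andP[-> xt] ->]; split => //; apply/negP; rewrite -ltNge.
  apply: (@le_trans _ _ (k^-1%:E * Q `]Num.max a t, b]%classic)%E); last first.
    apply: lee_wpmul2l; first by rewrite lee_fin ltW.
    apply: le_measure; rewrite ?inE//; apply: subset_itvr.
    by rewrite bnd_simp le_max lexx.
  have [maxb|maxb] := leP (Num.max a t) b; last first.
    by rewrite set_itv_ge ?measure0 ?mule0// bnd_simp -leNgt ltW.
  rewrite (unit_distribution_ocitv F Q)// (unit_distribution_ocitv id U)//.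
  rewrite -EFinM lee_fin ler_pdivlMl//.
  apply: kr; last by have /andP[] := clip_unit b.
  rewrite (clip_nondecreasing _ _ maxb) andbT.
  by rewrite -[leLHS]tE clip_nondecreasing// le_max lexx orbT.
rewrite (Rintegral_np_test_split Q D)//.
have := Rintegral_np_test_split U D psi mD tpsi; rewrite -/t.
rewrite /D (unit_distribution_cdf_clip F Q)// (unit_distribution_cdf_clip id U)//= tE.
rewrite -/D => tU.
have := right_le; rewrite ler_pdivlMl//.
have := congr1 ( *%R k) tU; lra.
Qed.

End bathtub.

(** * The canonical pair *)

Section canonical_pair.
Context {R : realType} (B : R -> R).
Hypothesis cB : np_curve B.
Local Notation borel := (measurableTypeR R).
Local Notation U := (uniform_prob (@ltr01 R)).

(** The law of [1 - B u], for [u] uniform on the unit interval. *)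
Lemma unit_distribution_np_cdf_exists :
  exists Q : probability borel R, unit_distribution_with_cdf (np_cdf B) Q.
Proof.
pose g (u : borel) : borel := 1 - B (clip u).
have g01 u : 0 <= g u <= 1.
  have c01 := clip_unit u.
  have := np_curve_ge0 B cB _ c01; have := np_curve_le1 B cB _ c01; rewrite /g; lra.
have mg : measurable_fun [set: borel] g.
  apply: nondecreasing_measurable => // x y xy.
  rewrite /g lerB// np_curve_nonincreasing//; first by have /andP[] := clip_unit x.
  by rewrite clip_nondecreasing//; have /andP[] := clip_unit y.
pose X : {RV U >-> borel} := HB.pack g (isMeasurableFun.Build _ _ _ _ g mg).
exists (distribution U X); split.
  rewrite /distribution /pushforward /= (_ : X @^-1` _ = setT) ?probability_setT//.
  by apply/seteqP; split=> u //= _; rewrite in_itv/=; exact: g01.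
move=> x /andP[x0 x1].
rewrite /distribution /pushforward /=.
have [{}x1|x1'] := ltP x 1; last first.
  rewrite /np_cdf ltNge x1' /= (_ : X @^-1` _ = setT) ?probability_setT//.
  apply/seteqP; split=> u //= _; rewrite in_itv/=.
  by have /andP[_ /le_trans] := g01 u; apply.
have x01 : 0 <= x <= 1 by rewrite x0 ltW.
have /andP[F0 F1] := np_cdf_unit B cB x x01.
set F := np_cdf B x in F0 F1 *.
set A := X @^-1` _.
have mA : measurable (A : set R).
  by rewrite -[A]setTI; exact: (mg measurableT _ (measurable_itv _)).
have AE u : A u = (g u <= x) by rewrite /A /= in_itv.
apply/eqP; rewrite eq_le; apply/andP; split.
  have <- : U (`[0, F]%classic : set R) = F%:E.
    apply: (uniform_prob_itv _ true false) => //.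
    by rewrite setIidl//; apply: subset_itvl; rewrite bnd_simp.
  rewrite !uniform_probE//.
  apply: le_measure; rewrite ?inE.
    exact: (measurableI _ _ mA (measurable_itv _)).
    exact: (measurableI _ _ (measurable_itv _) (measurable_itv _)).
  move=> u [Au u01]; split => //; move: u01 Au; rewrite AE /= !in_itv/= => u01 gu.
  have /andP[-> _] := u01 => /=; rewrite leNgt; apply/negP => Fu.
  (* by convexity B is below 1 - x to the right of its first passage F *)
  have BF := np_curve_np_cdf B cB x x01.
  have := np_curve_contract B cB F u F0 ltac:(lra).
  move: gu; rewrite /g clip_id// => gu; nra.
have <- : U (`]0, F[%classic : set R) = F%:E.
  apply: (uniform_prob_itv _ false true) => //.
  rewrite setIidl// => u /=; rewrite !in_itv/= => /andP[u0 uF].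
  by rewrite !ltW// (lt_le_trans uF F1).
apply: le_measure; rewrite ?inE//.
move=> u /=; rewrite in_itv/= => /andP[u0 uF]; rewrite AE leNgt; apply/negP.
have u01 : 0 <= u <= 1 by lra.
rewrite /g clip_id// => gx.
have := np_cdf_le B x u x1 u01; rewrite -/F; lra.
Qed.

(** The [bathtub] inequality needs a uniform mass less than 1, so it is applied to
    the rejection probability scaled by [s < 1], and [s] then tends to 1. *)
Lemma np_boundary_le_uniform (Q : probability borel R) (phi : borel -> R) :
  unit_distribution_with_cdf (np_cdf B) Q -> np_test phi ->
  B (false_positive_rate Q phi) <= false_negative_rate U phi.
Proof.
move=> QF tphi.
pose psi x := 1 - phi x.
have tpsi : np_test psi by exact: np_testC.
have Upsi : false_negative_rate U psi = 1 - false_negative_rate U phi.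
  exact: false_positive_rateE.
have -> : false_positive_rate Q phi = false_negative_rate Q psi by [].
have := false_negative_rate_unit U phi tphi.
have a01 := false_negative_rate_unit Q psi tpsi.
set b := false_negative_rate U phi in Upsi *; set a := false_negative_rate Q psi in a01 *.
move=> /andP[b0 b1].
apply/ler_addgt0Pr => e e0.
have [s /andP[s0 s1] se] : exists2 s : R, 0 <= s < 1 & 1 - s <= e.
  exists (1 - Num.min e 1); first by rewrite subr_ge0 ge_min lexx orbT gtrBl lt_min e0 ltr01.
  by rewrite subKr ge_min lexx.
have tspsi : np_test (fun x => s * psi x) by apply: np_testZ => //; lra.
have scaleE (P : probability borel R) :
    false_negative_rate P (fun x => s * psi x) = s * false_negative_rate P psi.
  by rewrite /false_negative_rate RintegralZl//; exact: np_test_integrable.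
have sb : 0 <= s * b by exact: mulr_ge0.
have t0 : 0 <= s * (1 - b) by apply: mulr_ge0 => //; lra.
have := bathtub Q (np_cdf B) _ (np_cdf0 B cB) (np_cdf_convex B cB) QF tspsi.
rewrite !scaleE Upsi -/a => /(_ ltac:(lra)) Fsa.
have Fa : np_cdf B (s * (1 - b)) <= a.
  by apply: le_trans Fsa _; apply: ler_piMl; lra.
have F01 := np_cdf_unit B cB (s * (1 - b)) ltac:(lra).
apply: le_trans (np_curve_nonincreasing B cB _ _ _ _) _; last first.
  apply: le_trans (np_curve_np_cdf B cB (s * (1 - b)) _) _; first by lra.
  have : s * b <= b by apply: ler_piMl => //; exact: ltW.
  by lra.
- by rewrite Fa; lra.
- by lra.
Qed.

(** When [B a > 0], reject exactly below the threshold [1 - B a], whose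
    [Q]-measure is [F (1 - B a) = a]. When [B a = 0], rejecting below 1 costs at
    most the level [a], and the rest of the level is spent on the atom at 1 by
    randomization. *)
Lemma np_boundary_uniform_attained (Q : probability borel R) (a : R) :
  unit_distribution_with_cdf (np_cdf B) Q -> 0 <= a <= 1 ->
  np_region U Q (a, B a).
Proof.
move=> QF a01.
have F0 := np_cdf0 B cB.
have UF := @uniform_unit_distribution R.
have Ba0 := np_curve_ge0 B cB a a01.
have [Bpos|Bnpos] := ltP 0 (B a).
  have Ba1 := np_curve_le1 B cB a a01.
  pose D : set borel := `]-oo, 1 - B a]%classic.
  have mD : measurable D by exact: measurable_itv.
  have mD' : measurable (~` D) by exact: measurableC.
  have t01 : 0 <= 1 - B a <= 1 by lra.
  have tD : np_test (\1_(~` D) : borel -> R) by exact: np_test_indic.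
  exists (\1_(~` D)) => //=.
  rewrite false_positive_rateE// !false_negative_rate_indic//.
  rewrite !probability_setC// QF.2// UF.2//= (np_cdf_np_curve B cB)//.
  by congr (_, _); lra.
have {Bnpos Ba0}Ba : B a = 0 by apply/le_anti; rewrite Bnpos.
pose D : set borel := `]-oo, 1[%classic.
have mD : measurable D by exact: measurable_itv.
have mD' : measurable (~` D) by exact: measurableC.
have QD : (Q D <= a%:E)%E.
  apply: (unit_distribution_lt1 (np_cdf B)) => // x /andP[x0 x1].
  by apply: np_cdf_le => //; rewrite Ba; lra.
have UD : U D = 1%E.
  apply: (uniform_prob_itv _ true true) => //.
  apply/seteqP; split=> y /=; rewrite !in_itv/=; first by move=> [-> /andP[->]].
  by move=> /andP[-> y1]; rewrite y1 ltW.
pose q := fine (Q (~` D)).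
have qE : q = 1 - fine (Q D).
  by rewrite /q probability_setC// fineB// fin_num_measure.
have qa : 1 - a <= q.
  rewrite qE lerB// -lee_fin fineK// fin_num_measure//.
(* if q = 0 then a = 1, and the division by zero gives the right value c = 0 *)
pose c := (1 - a) / q.
have cq : c * q = 1 - a.
  have [q0|q0] := eqVneq q 0; last by rewrite /c divfK.
  by rewrite q0 mulr0; lra.
have c01 : 0 <= c <= 1.
  have q0 : 0 <= q by rewrite /q fine_ge0.
  apply/andP; split; first by rewrite divr_ge0//; lra.
  have [q_eq0|q_neq0] := eqVneq q 0; first by rewrite /c q_eq0 invr0 mulr0.
  by rewrite ler_pdivrMr ?mul1r// lt_neqAle eq_sym q_neq0.
have tD : np_test (\1_(~` D) : borel -> R) by exact: np_test_indic.
have tcD := np_testZ c _ c01 tD.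
exists (fun x => c * \1_(~` D) x) => //=.
have scaleE (P : probability borel R) :
    false_negative_rate P (fun x => c * \1_(~` D) x) = c * fine (P (~` D)).
  rewrite -false_negative_rate_indic// /false_negative_rate RintegralZl//.
  exact: np_test_integrable.
have UDC : fine (U (~` D)) = 0 by rewrite probability_setC// [X in (_ - X)%E]UD subee.
rewrite false_positive_rateE// !scaleE -/q cq Ba UDC mulr0.
by congr (_, _); lra.
Qed.

End canonical_pair.

Theorem theorem4 (R : realType) (d : measure_display) (T : measurableType d)
    (P0 Q0 : probability T R) (B : R -> R)
    (hB : is_np_boundary P0 Q0 B) :
  (exists Q : probability (measurableTypeR R) R,
     unit_distribution_with_cdf (np_cdf B) Q) /\
  (forall Q : probability (measurableTypeR R) R,
     unit_distribution_with_cdf (np_cdf B) Q ->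
     is_np_boundary (uniform_prob (@ltr01 R)) Q B).
Proof.
have cB := np_boundary_np_curve P0 Q0 B hB.
split; first exact: unit_distribution_np_cdf_exists.
move=> Q QF alpha alpha01; split; first exact: np_boundary_uniform_attained.
by move=> beta [phi tphi [<- <-]]; exact: np_boundary_le_uniform.
Qed.
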